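(* Let $\mathbf z=(z_1,z_2,z_3,\ldots)$ be a sequence of real numbers with $0<z_1<z_2<\cdots$ such that $z_n\ge \varepsilon n$ for all $n\ge1$, for some $\varepsilon>0$. Let $\alpha\in\mathbb R$ be such that either $\alpha>0$, or $\alpha=0$ and $\sum_{n\ge1} z_n^{-1}$ converges. Suppose that the sequence \[ P_N:=\frac{z_1+z_N}{z_{N+1}-z_N}\cdot\frac{z_1+z_{N-1}}{z_{N+1}-z_{N-1}}\cdots\frac{z_1+z_1}{z_{N+1}-z_1},\qquad N=1,2,\ldots, \] is bounded. For integers $n\ge1$, $k\ge0$ put $(n;k)_{\mathbf z,\alpha}:=z_n^\alpha\prod_{i=1}^k(z_n-z_i)$, and for $k\ge1$ set \[ \gamma_k(x):=\frac{1}{z_k-x}\cdot\frac{1}{(k;k-1)_{\mathbf z,\alpha}}+\sum_{n=k+1}^\infty\frac{1}{(n;k)_{\mathbf z,\alpha}}. \] Then for all complex $x$ with $|x|<z_1$, \[ \sum_{n=1}^\infty\frac{1}{(z_n-x)z_n^\alpha}=\sum_{k=1}^\infty\gamma_k(x)\prod_{\ell=1}^{k-1}(x-z_\ell). \]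
   Context: Empty products equal $1$. *)

(* Defs.v *)
From Stdlib Require Import Reals.
From Coquelicot Require Import Coquelicot.
Open Scope R_scope.

(* Sequences are indexed from 1: the value [z 0] is never used.
   The products run over 1 <= i <= k, and are 1 when k = 0. *)
Definition prodR (f : nat -> R) (k : nat) : R := Iter.iter_nat Rmult 1 f 1 k.
Definition prodC (f : nat -> C) (k : nat) : C :=
  Iter.iter_nat Cmult (RtoC 1) f 1 k.

Definition P (z : nat -> R) (N : nat) : R :=
  prodR (fun j => (z 1%nat + z j) / (z (S N) - z j)) N.

(* (n;k)_{z,alpha}; [Rpower] is the real power since z_n > 0. *)
Definition paren (z : nat -> R) (alpha : R) (n k : nat) : R :=
  Rpower (z n) alpha * prodR (fun i => z n - z i) k.

(* The terms 1/(n;k)_{z,alpha}, n = k+1, k+2, ..., indexed by m = n - k - 1. *)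
Definition gamma_tail (z : nat -> R) (alpha : R) (k m : nat) : R :=
  / paren z alpha (S k + m) k.

(* Meaningful for k >= 1. [Series] is total; it is the sum of the series when
   [ex_series (gamma_tail z alpha k)] holds. *)
Definition gamma (z : nat -> R) (alpha : R) (k : nat) (x : C) : C :=
  (/ (RtoC (z k) - x) * / RtoC (paren z alpha k (k - 1))
   + RtoC (Series (gamma_tail z alpha k)))%C.

(* Main.v *)
(** Put [newton_rem K n = prod_(l <= K) (x - z_l) / ((z_n - x) (n;K))].  Newton
    interpolation of [1/(z_n - x)] at [z_1, z_2, ...] is the identity
    [newton_rem K n - newton_rem (K+1) n = prod_(l <= K) (x - z_l) / (n;K+1)].
    Summing it over [n > K + 1] shows that the left-hand sum minus the [K]-th
    partial sum of the right-hand series is [sum_(n > K) newton_rem K n].  For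
    [n > K] the factor [prod_(l <= K) |x - z_l| / (z_n - z_l)] of
    [|newton_rem K n|] is at most [P_K], so this error is bounded by a constant
    times a tail of the convergent series of the [1/((z_n - |x|) z_n^alpha)]. *)

Require Import Defs.
From Stdlib Require Import Reals Lra Lia.
From Coquelicot Require Import Coquelicot.
Open Scope R_scope.

(** * Finite products, and convergence of real and complex series *)

Lemma prodR_0 (f : nat -> R) : prodR f 0 = 1.
Proof. reflexivity. Qed.

Lemma prodC_0 (f : nat -> C) : prodC f 0 = RtoC 1.
Proof. reflexivity. Qed.

Lemma prodR_S (f : nat -> R) (k : nat) : prodR f (S k) = prodR f k * f (S k).
Proof.
  unfold prodR.
  rewrite (Iter.iter_nat_Chasles Rmult 1 Rmult_1_l
             (fun a b c => eq_sym (Rmult_assoc a b c)) f 1 k (S k)) by lia.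
  now rewrite (Iter.iter_nat_point Rmult 1 Rmult_1_r).
Qed.

Lemma prodC_S (f : nat -> C) (k : nat) :
  prodC f (S k) = (prodC f k * f (S k))%C.
Proof.
  unfold prodC.
  rewrite (Iter.iter_nat_Chasles Cmult (RtoC 1) Cmult_1_l Cmult_assoc f 1 k (S k))
    by lia.
  now rewrite (Iter.iter_nat_point Cmult (RtoC 1) Cmult_1_r).
Qed.

Lemma prodR_pos (f : nat -> R) (k : nat) :
  (forall i, (1 <= i <= k)%nat -> 0 < f i) -> 0 < prodR f k.
Proof.
  induction k as [|k IH]; intros Hf.
  - rewrite ?prodR_0; lra.
  - rewrite prodR_S; apply Rmult_lt_0_compat; [apply IH; intros; apply Hf|apply Hf]; lia.
Qed.

Lemma prodR_le (f g : nat -> R) (k : nat) :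
  (forall i, (1 <= i <= k)%nat -> 0 <= f i <= g i) ->
  0 <= prodR f k <= prodR g k.
Proof.
  induction k as [|k IH]; intros Hf.
  - rewrite ?prodR_0; lra.
  - rewrite !prodR_S.
    assert (H1 : 0 <= prodR f k <= prodR g k) by (apply IH; intros; apply Hf; lia).
    assert (H2 : 0 <= f (S k) <= g (S k)) by (apply Hf; lia).
    split; [apply Rmult_le_pos|apply Rmult_le_compat]; lra.
Qed.

Lemma Cmod_prodC_div (f : nat -> C) (g : nat -> R) (k : nat) :
  Cmod (prodC f k) / prodR g k = prodR (fun i => Cmod (f i) / g i) k.
Proof.
  induction k as [|k IH].
  - rewrite prodC_0, !prodR_0, Cmod_1; field.
  - rewrite prodC_S, !prodR_S, Cmod_mult, <- IH.
    unfold Rdiv; rewrite Rinv_mult; ring.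
Qed.

(** The triangle inequality holds for partial sums and survives the limit because the norm is
    continuous. It turns a termwise bound on the remainders into a bound on their sum. *)
Lemma is_series_norm_le {K : AbsRing} {V : NormedModule K}
    (a : nat -> V) (b : nat -> R) (l : V) (B : R) :
  is_series a l -> is_series b B -> (forall n, norm (a n) <= b n) -> norm l <= B.
Proof.
  intros Ha Hb Hab.
  apply (is_lim_seq_le (fun n => norm (sum_n a n)) (sum_n b) (norm l) B).
  - intros n. apply Rle_trans with (1 := norm_sum_n_m a 0 n).
    now apply sum_n_m_le.
  - exact (filterlim_comp _ _ _ _ _ _ _ _ Ha (filterlim_norm l)).
  - exact Hb.
Qed.

Lemma is_series_RtoC (a : nat -> R) (l : R) :
  is_series a l ->
  @is_series C_AbsRing C_NormedModule (fun n => RtoC (a n)) (RtoC l).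
Proof.
  intros Ha.
  assert (Hs : forall n, RtoC (sum_n a n) =
                 sum_n (fun k => RtoC (a k) : C_NormedModule) n).
  { induction n as [|n IH].
    - now rewrite !sum_O.
    - rewrite !sum_Sn, <- IH. apply RtoC_plus. }
  apply (filterlim_ext _ _ Hs).
  apply (filterlim_comp _ _ _ (sum_n a) RtoC _ (locally l) _ Ha).
  (* A ball of [C] is a product of balls in the two coordinates; both imaginary parts are 0, so only
     the real coordinate has to be checked. *)
  intros Q [e He]. exists e. intros y Hy. apply He. split.
  - exact Hy.
  - apply ball_center.
Qed.

Lemma ex_series_bounded (a : nat -> R) (M : R) :
  (forall n, 0 <= a n) -> (forall n, sum_n a n <= M) -> ex_series a.
Proof.
  intros Ha HM.
  destruct (ex_finite_lim_seq_incr (sum_n a) M) as [l Hl]; [|exact HM|now exists l].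
  intros n. rewrite sum_Sn. unfold plus; simpl. specialize (Ha (S n)). lra.
Qed.

Lemma ex_series_le_pos (a b : nat -> R) :
  (forall n, 0 <= a n <= b n) -> ex_series b -> ex_series a.
Proof.
  intros Hab Hb. apply (ex_series_le a b); [|exact Hb].
  intros n. change (Rabs (a n) <= b n). rewrite Rabs_pos_eq; apply Hab.
Qed.

(** * Convergence of the sum of [1 / n^(1+a)] for [a > 0] *)

Lemma Rpower_pos (x y : R) : 0 < Rpower x y.
Proof. apply exp_pos. Qed.

(** After multiplication by [(x+1)^a] this reads [1 + a/(x+1) <= ((x+1)/x)^a]. It follows from
    [1 + t <= exp t] used twice: for the power itself, and at [t = ln x - ln (x+1)] to get
    [ln (x+1) - ln x >= 1/(x+1)]. The right-hand side telescopes when summed over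
    [x = 1, 2, ...]. *)
Lemma Rpower_inv_telescope (a x : R) :
  0 < a -> 0 < x ->
  a * / ((x + 1) * Rpower (x + 1) a) <= / Rpower x a - / Rpower (x + 1) a.
Proof.
  intros Ha Hx.
  assert (Hp := Rpower_pos (x + 1) a). assert (Hq := Rpower_pos x a).
  assert (Hr : 1 + a / (x + 1) <= Rpower (x + 1) a * / Rpower x a).
  { rewrite <- Rpower_Ropp. unfold Rpower. rewrite <- exp_plus.
    eapply Rle_trans; [|apply exp_ineq1_le]. apply Rplus_le_compat_l.
    assert (Hl : ln x - ln (x + 1) <= - / (x + 1)).
    { assert (He := exp_ineq1_le (ln x - ln (x + 1))).
      unfold Rminus in He; rewrite exp_plus, exp_Ropp, !exp_ln in He by lra.
      replace (x * / (x + 1)) with (1 - / (x + 1)) in He by (field; lra). lra. }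
    assert (a * (/ (x + 1)) <= a * (ln (x + 1) - ln x))
      by (apply Rmult_le_compat_l; lra).
    unfold Rdiv; lra. }
  apply (Rmult_le_compat_l (/ Rpower (x + 1) a)) in Hr;
    [|apply Rlt_le, Rinv_0_lt_compat, Hp].
  replace (/ Rpower (x + 1) a * (Rpower (x + 1) a * / Rpower x a))
    with (/ Rpower x a) in Hr by (field; lra).
  replace (a * / ((x + 1) * Rpower (x + 1) a))
    with (/ Rpower (x + 1) a * (1 + a / (x + 1)) - / Rpower (x + 1) a)
    by (field; lra).
  lra.
Qed.

Lemma ex_series_Rpower (a : R) :
  0 < a -> ex_series (fun m => / (INR (S m) * Rpower (INR (S m)) a)).
Proof.
  intros Ha.
  assert (Hpos : forall m, 0 < / (INR (S m) * Rpower (INR (S m)) a)).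
  { intros m. apply Rinv_0_lt_compat, Rmult_lt_0_compat;
      [apply lt_0_INR; lia|apply Rpower_pos]. }
  apply (ex_series_bounded _ (1 + / a)); [intros m; apply Rlt_le, Hpos|].
  intros n.
  (* The sharper bound keeps the telescoped boundary term, which is what lets the induction close;
     the leading 1 is the first term of the series. *)
  apply Rle_trans with (1 + / a * (1 - / Rpower (INR (S n)) a)).
  - induction n as [|n IH].
    + rewrite sum_O. simpl INR. unfold Rpower. rewrite ln_1, Rmult_0_r, exp_0. lra.
    + rewrite sum_Sn.
      change (plus ?p ?q) with (p + q).
      assert (H := Rpower_inv_telescope a (INR (S n)) Ha (lt_0_INR (S n) ltac:(lia))).
      rewrite <- S_INR in H.
      apply (Rmult_le_compat_l (/ a)) in H; [|apply Rlt_le, Rinv_0_lt_compat, Ha].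
      rewrite <- Rmult_assoc, Rinv_l, Rmult_1_l in H by lra.
      lra.
  - apply Rplus_le_compat_l. rewrite <- (Rmult_1_r (/ a)) at 2.
    apply Rmult_le_compat_l; [apply Rlt_le, Rinv_0_lt_compat, Ha|].
    assert (H := Rinv_0_lt_compat _ (Rpower_pos (INR (S n)) a)). lra.
Qed.

(** * Increasing sequences [z] and the real series built from them *)

Section Newton.

Variables (z : nat -> R) (alpha : R).
Hypothesis z1_pos : 0 < z 1%nat.
Hypothesis z_incr : forall n, (1 <= n)%nat -> z n < z (S n).

Let w (n : nat) : R := Rpower (z n) alpha.

Lemma z_lt (i j : nat) : (1 <= i < j)%nat -> z i < z j.
Proof.
  intros [Hi Hj]. induction Hj as [|j Hj IH].
  - now apply z_incr.
  - apply Rlt_trans with (1 := IH), z_incr. lia.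
Qed.

Lemma z_le (i j : nat) : (1 <= i <= j)%nat -> z i <= z j.
Proof.
  intros H. destruct (Nat.eq_dec i j) as [->|Hij]; [lra|].
  apply Rlt_le, z_lt; lia.
Qed.

Lemma z_pos (n : nat) : (1 <= n)%nat -> 0 < z n.
Proof. intros H. apply Rlt_le_trans with (1 := z1_pos), z_le; lia. Qed.

(** For [alpha > 0], [z_n >= eps n] gives [z_n^(1+alpha) >= (eps n)^(1+alpha)], so the series is
    dominated by a multiple of the sum of [1 / n^(1+alpha)]. For [alpha = 0] the power is 1 and
    convergence is assumed. *)
Lemma ex_series_z_Rpower :
  (exists eps, 0 < eps /\ forall n, (1 <= n)%nat -> eps * INR n <= z n) ->
  0 < alpha \/ (alpha = 0 /\ ex_series (fun m => / z (S m))) ->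
  ex_series (fun m => / (z (S m) * w (S m))).
Proof.
  unfold w. intros [eps [Heps Hz]] [Ha|[-> Hs]].
  - apply (ex_series_le_pos _
             (fun m => / (eps * Rpower eps alpha) *
                       / (INR (S m) * Rpower (INR (S m)) alpha))).
    2: apply (ex_series_scal_l (K := R_AbsRing) (V := R_NormedModule)
                (/ (eps * Rpower eps alpha)) _ (ex_series_Rpower alpha Ha)).
    intros m.
    assert (Hm : 0 < INR (S m)) by (apply lt_0_INR; lia).
    assert (Hb := Rmult_lt_0_compat _ _ Heps Hm).
    assert (Hzm : eps * INR (S m) <= z (S m)) by (apply Hz; lia).
    assert (Hp := Rpower_pos (z (S m)) alpha).
    split.
    + apply Rlt_le, Rinv_0_lt_compat, Rmult_lt_0_compat; lra.
    + rewrite <- Rinv_mult.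
      replace (eps * Rpower eps alpha * (INR (S m) * Rpower (INR (S m)) alpha))
        with ((eps * INR (S m)) * Rpower (eps * INR (S m)) alpha)
        by (rewrite <- Rpower_mult_distr by lra; ring).
      assert (Hq := Rpower_pos (eps * INR (S m)) alpha).
      apply Rinv_le_contravar; [now apply Rmult_lt_0_compat|].
      apply Rmult_le_compat; try lra. apply Rle_Rpower_l; lra.
  - apply ex_series_ext with (2 := Hs). intros m.
    rewrite Rpower_O, Rmult_1_r; [reflexivity|apply z_pos; lia].
Qed.

Hypothesis z_summable : ex_series (fun m => / (z (S m) * w (S m))).

(** Since [z_n >= z_(k+1)] for [n > k], one has [z_n - t >= c z_n] with [c = 1 - t / z_(k+1) > 0].
    This serves [t = z_k] in the tails of [gamma], and [k = 0], [t = |x|] in the series dominating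
    the remainders. *)
Lemma ex_series_shifted (k : nat) (t : R) :
  0 <= t < z (S k) -> ex_series (fun m => / ((z (S k + m) - t) * w (S k + m))).
Proof.
  intros Ht.
  assert (Hk : 0 < z (S k)) by (apply z_pos; lia).
  set (c := 1 - t / z (S k)).
  assert (Hc : 0 < c).
  { unfold c. apply Rmult_lt_reg_r with (1 := Hk).
    replace ((1 - t / z (S k)) * z (S k)) with (z (S k) - t) by (field; lra). lra. }
  apply (ex_series_le_pos _ (fun m => / c * / (z (S (k + m)) * w (S (k + m))))).
  - intros m. change (S k + m)%nat with (S (k + m)).
    assert (Hz : z (S k) <= z (S (k + m))) by (apply z_le; lia).
    assert (Hw := Rpower_pos (z (S (k + m))) alpha). fold (w (S (k + m))) in Hw.
    assert (Hcz : 0 < c * z (S (k + m))) by (apply Rmult_lt_0_compat; lra).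
    assert (Hle : c * z (S (k + m)) <= z (S (k + m)) - t).
    { unfold c.
      assert (t / z (S k) * z (S k) <= t / z (S k) * z (S (k + m))).
      { apply Rmult_le_compat_l; [|lra].
        apply Rmult_le_pos; [lra|apply Rlt_le, Rinv_0_lt_compat, Hk]. }
      replace (t / z (S k) * z (S k)) with t in H by (field; lra). lra. }
    split.
    + apply Rlt_le, Rinv_0_lt_compat, Rmult_lt_0_compat; lra.
    + rewrite <- Rinv_mult, <- Rmult_assoc.
      apply Rinv_le_contravar; [now apply Rmult_lt_0_compat|].
      apply Rmult_le_compat_r; lra.
  - apply (ex_series_scal_l (K := R_AbsRing) (V := R_NormedModule) (/ c)).
    apply (ex_series_incr_n (fun m => / (z (S m) * w (S m))) k), z_summable.
Qed.

Lemma paren_pos (n k : nat) : (k < n)%nat -> 0 < paren z alpha n k.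
Proof.
  intros Hk. apply Rmult_lt_0_compat; [apply Rpower_pos|].
  apply prodR_pos. intros i Hi. assert (z i < z n) by (apply z_lt; lia). lra.
Qed.

Lemma paren_S (n k : nat) :
  paren z alpha n (S k) = paren z alpha n k * (z n - z (S k)).
Proof. unfold paren. rewrite prodR_S. ring. Qed.

(** In [(n;k)] the factor [z_n - z_k] is kept, and each [z_n - z_i] with [i < k] is bounded below by
    its value at the first index [n = k+1]. What remains is a multiple of a shifted series with
    [t = z_k]. *)
Lemma ex_series_gamma_tail (k : nat) :
  (1 <= k)%nat -> ex_series (gamma_tail z alpha k).
Proof.
  destruct k as [|k]; [lia|intros _].
  assert (Hk : 0 < z (S k)) by (apply z_pos; lia).
  assert (Hk' : z (S k) < z (S (S k))) by (apply z_lt; lia).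
  set (c := prodR (fun i => z (S (S k)) - z i) k).
  assert (Hc : 0 < c).
  { apply prodR_pos. intros i Hi. assert (z i < z (S (S k))) by (apply z_lt; lia). lra. }
  apply (ex_series_le_pos _ (fun m => / c *
            / ((z (S (S k) + m) - z (S k)) * w (S (S k) + m)))).
  - intros m. unfold gamma_tail. set (n := (S (S k) + m)%nat).
    assert (Hzn : z (S (S k)) <= z n) by (apply z_le; unfold n; lia).
    assert (Hw := Rpower_pos (z n) alpha). fold (w n) in Hw.
    split.
    + apply Rlt_le, Rinv_0_lt_compat, paren_pos. unfold n; lia.
    + rewrite <- Rinv_mult, paren_S. unfold paren. fold (w n).
      apply Rinv_le_contravar.
      * repeat apply Rmult_lt_0_compat; lra.
      * assert (Hcn : 0 <= c <= prodR (fun i => z n - z i) k).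
        { apply prodR_le. intros i Hi.
          assert (z i < z (S (S k))) by (apply z_lt; lia). lra. }
        replace (w n * prodR (fun i => z n - z i) k * (z n - z (S k)))
          with (prodR (fun i => z n - z i) k * ((z n - z (S k)) * w n)) by ring.
        apply Rmult_le_compat_r; [|lra].
        apply Rmult_le_pos; lra.
  - apply (ex_series_scal_l (K := R_AbsRing) (V := R_NormedModule) (/ c)).
    apply (ex_series_shifted (S k) (z (S k))). lra.
Qed.

(** * Newton remainders at a point [x] of the disc, and summation of the interpolation identity *)

Variable x : C.
Hypothesis x_lt : Cmod x < z 1%nat.

Let node (k : nat) : C := prodC (fun l => x - RtoC (z l))%C k.

Definition newton_rem (k n : nat) : C :=
  (node k * / ((RtoC (z n) - x) * RtoC (paren z alpha n k)))%C.

Lemma Cmod_sub_ge (n : nat) : z n - Cmod x <= Cmod (RtoC (z n) - x).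
Proof.
  assert (H := Cmod_triangle (RtoC (z n) - x) x).
  replace (RtoC (z n) - x + x)%C with (RtoC (z n)) in H by ring.
  rewrite Cmod_R in H. assert (H' := Rle_abs (z n)). lra.
Qed.

Lemma Cmod_x_lt (n : nat) : (1 <= n)%nat -> Cmod x < z n.
Proof. intros H. apply Rlt_le_trans with (1 := x_lt), z_le; lia. Qed.

Lemma z_sub_x_neq_0 (n : nat) : (1 <= n)%nat -> (RtoC (z n) - x)%C <> 0.
Proof.
  intros Hn. apply Cmod_gt_0.
  assert (H := Cmod_sub_ge n). assert (H' := Cmod_x_lt n Hn). lra.
Qed.

Lemma RtoC_neq_0 (r : R) : r <> 0 -> RtoC r <> 0.
Proof. intros H E. apply H. now apply RtoC_inj. Qed.

(** This is the partial fraction identity [(x - a) / ((z_n - x)(z_n - a)) = 1/(z_n - x) - 1/(z_n -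
    a)] at [a = z_(k+1)]. At [n = k+1] the denominator [z_n - a] would vanish. *)
Lemma newton_rem_S (k n : nat) :
  (S k < n)%nat ->
  newton_rem (S k) n =
  (newton_rem k n - node k * RtoC (/ paren z alpha n (S k)))%C.
Proof.
  intros Hn. unfold newton_rem, node.
  assert (H1 := z_sub_x_neq_0 n ltac:(lia)).
  assert (Hp := paren_pos n k ltac:(lia)).
  assert (Hz := z_lt (S k) n ltac:(lia)).
  assert (H2 := RtoC_neq_0 (paren z alpha n k) ltac:(lra)).
  assert (H3 := RtoC_neq_0 (z n - z (S k)) ltac:(lra)).
  rewrite RtoC_inv by (rewrite paren_S; apply Rmult_integral_contrapositive; lra).
  rewrite prodC_S, paren_S, RtoC_mult, RtoC_minus in *.
  field. repeat split; assumption.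
Qed.

(** The first summand of [gamma] is exactly the remainder at [n = k+1], the one index that the
    recurrence in [k] cannot reach. *)
Lemma gamma_node (k : nat) :
  (gamma z alpha (S k) x * node k)%C =
  (newton_rem k (S k) + node k * RtoC (Series (gamma_tail z alpha (S k))))%C.
Proof.
  unfold gamma, newton_rem. replace (S k - 1)%nat with k by lia.
  assert (H1 := z_sub_x_neq_0 (S k) ltac:(lia)).
  assert (Hp := paren_pos (S k) k ltac:(lia)).
  assert (H2 := RtoC_neq_0 (paren z alpha (S k) k) ltac:(lra)).
  field. now split.
Qed.

(** The term [n = k+1] is split off and the recurrence is summed over [n > k+1]; by [gamma_node] the
    two losses together make up one term of the right-hand series. *)
Lemma is_series_newton_rem_S (k : nat) (l : C) :
  @is_series C_AbsRing C_NormedModule (fun m => newton_rem k (S k + m)) l ->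
  @is_series C_AbsRing C_NormedModule (fun m => newton_rem (S k) (S (S k) + m))
    (l - gamma z alpha (S k) x * node k)%C.
Proof.
  intros Hl.
  assert (Hg := is_series_RtoC _ _
                  (Series_correct _ (ex_series_gamma_tail (S k) ltac:(lia)))).
  apply (is_series_scal_l (node k : C_AbsRing)) in Hg.
  assert (Hl' : @is_series C_AbsRing C_NormedModule
                  (fun m => newton_rem k (S k + S m)) (l - newton_rem k (S k))%C).
  { apply (is_series_incr_1 (fun m => newton_rem k (S k + m) : C_NormedModule)).
    rewrite Nat.add_0_r.
    replace (plus _ _) with (l : C_NormedModule); [exact Hl|].
    change (l = l - newton_rem k (S k) + newton_rem k (S k))%C. ring. }
  assert (H := is_series_minus _ _ _ _ Hl' Hg).
  rewrite gamma_node.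
  match type of H with is_series _ ?s =>
    replace (l - _)%C with (s : C)
      by (unfold plus, opp, scal; simpl; unfold mult; simpl; ring)
  end.
  apply is_series_ext with (2 := H). intros m.
  rewrite newton_rem_S by lia. rewrite Nat.add_succ_r. reflexivity.
Qed.

(** The comparison with [P z k] is factor by factor: [|x - z_i| <= z_1 + z_i] as [|x| < z_1], and
    [z_n - z_i >= z_(k+1) - z_i] as [n > k]. *)
Lemma Cmod_newton_rem_le (M : R) (k n : nat) :
  (forall N, (1 <= N)%nat -> Rabs (P z N) <= M) -> (k < n)%nat ->
  Cmod (newton_rem k n) <= Rmax 1 M * / ((z n - Cmod x) * w n).
Proof.
  intros HM Hk.
  assert (Hx := Cmod_x_lt n ltac:(lia)).
  assert (Hd := Cmod_sub_ge n).
  assert (Hp := paren_pos n k Hk).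
  assert (Hw := Rpower_pos (z n) alpha). fold (w n) in Hw.
  assert (Hq : 0 < prodR (fun i => z n - z i) k).
  { apply prodR_pos. intros i Hi. assert (z i < z n) by (apply z_lt; lia). lra. }
  unfold newton_rem.
  rewrite Cmod_mult, Cmod_inv, Cmod_mult, Cmod_R, Rabs_pos_eq by
    (try apply Cmult_neq_0; try apply z_sub_x_neq_0; try apply RtoC_neq_0; lia || lra).
  replace (Cmod (node k) * / (Cmod (RtoC (z n) - x) * paren z alpha n k))
    with (Cmod (node k) / prodR (fun i => z n - z i) k *
          / (Cmod (RtoC (z n) - x) * w n)).
  2: { unfold paren. fold (w n). field. repeat split; lra. }
  unfold node. rewrite Cmod_prodC_div.
  assert (Hprod : 0 <= prodR (fun i => Cmod (x - RtoC (z i)) / (z n - z i)) k <= P z k).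
  { apply prodR_le. intros i Hi.
    assert (z i < z (S k)) by (apply z_lt; lia).
    assert (z (S k) <= z n) by (apply z_le; lia).
    assert (Hi' : Cmod (x - RtoC (z i)) <= z 1%nat + z i).
    { eapply Rle_trans; [apply Cmod_triangle|].
      rewrite Cmod_opp, Cmod_R, Rabs_pos_eq; [lra|apply Rlt_le, z_pos; lia]. }
    assert (Hg := Cmod_ge_0 (x - RtoC (z i))).
    assert (0 < / (z n - z i)) by (apply Rinv_0_lt_compat; lra).
    split; [apply Rmult_le_pos; lra|].
    apply Rmult_le_compat; try lra.
    apply Rinv_le_contravar; lra. }
  (* [M] bounds [P z N] only for [N >= 1]; the maximum with 1 covers the empty product at
     [k = 0]. *)
  assert (HPk : P z k <= Rmax 1 M).
  { destruct k as [|k].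
    - apply Rle_trans with 1; [unfold P; rewrite prodR_0; lra|apply Rmax_l].
    - eapply Rle_trans; [|apply Rmax_r].
      eapply Rle_trans; [apply Rle_abs|apply HM; lia]. }
  apply Rmult_le_compat; try lra.
  - apply Rlt_le, Rinv_0_lt_compat, Rmult_lt_0_compat; lra.
  - apply Rinv_le_contravar; [apply Rmult_lt_0_compat; lra|].
    apply Rmult_le_compat_r; lra.
Qed.

Lemma newton_series (M : R) :
  (forall N, (1 <= N)%nat -> Rabs (P z N) <= M) ->
  exists s : C,
    @is_series C_AbsRing C_NormedModule
      (fun m => (/ ((RtoC (z (S m)) - x) * RtoC (w (S m))))%C) s /\
    @is_series C_AbsRing C_NormedModule
      (fun m => (gamma z alpha (S m) x * node m)%C) s.
Proof.
  intros HM.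
  set (u := fun m => Rmax 1 M * / ((z (S m) - Cmod x) * w (S m))).
  assert (Hu : ex_series u).
  { apply (ex_series_scal_l (K := R_AbsRing) (V := R_NormedModule) (Rmax 1 M)).
    apply (ex_series_shifted 0 (Cmod x)). split; [apply Cmod_ge_0|exact x_lt]. }
  destruct Hu as [B HB].
  (* Domination by [u] gives convergence by completeness of [C]. At [k = 0] both products are empty,
     so these remainders are the terms of the left-hand series. *)
  assert (H0 : ex_series (fun m => newton_rem 0 (S m) : C_CompleteNormedModule)).
  { apply (ex_series_le _ u); [|now exists B].
    intros m. apply (Cmod_newton_rem_le M 0 (S m) HM). lia. }
  destruct H0 as [s Hs]. exists s. split.
  - apply is_series_ext with (2 := Hs). intros m.
    unfold newton_rem, node, paren.
    rewrite prodC_0, prodR_0, Rmult_1_r. now rewrite Cmult_1_l.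
  - set (c := fun m => (gamma z alpha (S m) x * node m)%C : C_NormedModule).
    (* [sum_n c K] has [K+1] terms, hence the remainder of order [S K], summed from [n = K+2]. *)
    assert (Hrem : forall K, @is_series C_AbsRing C_NormedModule
              (fun m => newton_rem (S K) (S (S K) + m)) (s - sum_n c K)%C).
    { induction K as [|K IH].
      - rewrite sum_O. apply (is_series_newton_rem_S 0 s), Hs.
      - apply is_series_newton_rem_S in IH.
        rewrite sum_Sn.
        replace (s - plus _ _)%C with (s - sum_n c K - c (S K))%C; [exact IH|].
        unfold plus; simpl; ring. }
    (* The bound is the tail of [u] from index [K+1] on; its constant does not depend on the order
       of the remainder, so it tends to 0. *)
    assert (Htail : forall K, Cmod (s - sum_n c K)%C <= B - sum_n u K).
    { intros K.
      apply (is_series_norm_le (K := C_AbsRing) (V := C_NormedModule)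
               _ (fun m => u (S K + m)%nat) _ _ (Hrem K)).
      - apply is_series_incr_n; [lia|].
        replace (plus _ _) with B; [exact HB|].
        assert (E : forall p q : R, p = p - q + q) by (intros; ring).
        apply E.
      - intros m. apply (Cmod_newton_rem_le M (S K) (S (S K) + m) HM). lia. }
    (* Convergence is tested on balls of the norm [Cmod] instead of the product balls of [C], so
       that [Htail] applies directly. *)
    apply (filterlim_locally_ball_norm (sum_n c) s).
    intros e.
    assert (Hlim : is_lim_seq (sum_n u) B) by exact HB.
    apply is_lim_seq_spec in Hlim. destruct (Hlim e) as [N HN].
    exists N. intros K HK. specialize (HN K HK).
    unfold ball_norm. change (Cmod (sum_n c K - s)%C < e).
    replace (sum_n c K - s)%C with (- (s - sum_n c K))%C by ring.
    rewrite Cmod_opp. apply Rle_lt_trans with (1 := Htail K).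
    apply Rle_lt_trans with (2 := HN).
    rewrite Rabs_minus_sym. apply Rle_abs.
Qed.

End Newton.


Theorem theorem2p2 :
  forall (z : nat -> R) (alpha : R),
    0 < z 1%nat ->
    (forall n : nat, (1 <= n)%nat -> z n < z (S n)) ->
    (exists eps : R, 0 < eps /\
       forall n : nat, (1 <= n)%nat -> eps * INR n <= z n) ->
    (0 < alpha \/ (alpha = 0 /\ ex_series (fun m : nat => / z (S m)))) ->
    (exists M : R, forall N : nat, (1 <= N)%nat -> Rabs (P z N) <= M) ->
    (forall k : nat, (1 <= k)%nat -> ex_series (gamma_tail z alpha k)) /\
    (forall x : C, Cmod x < z 1%nat ->
       exists s : C,
         @is_series C_AbsRing C_NormedModule
           (fun m : nat =>
              (/ ((RtoC (z (S m)) - x) * RtoC (Rpower (z (S m)) alpha)))%C) s /\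
         @is_series C_AbsRing C_NormedModule
           (fun m : nat =>
              (gamma z alpha (S m) x
               * prodC (fun l : nat => x - RtoC (z l)) (S m - 1))%C) s).
Proof.
  intros z alpha Hz1 Hz Heps Ha [M HM].
  assert (Hsum := ex_series_z_Rpower z alpha Hz1 Hz Heps Ha).
  split.
  - exact (ex_series_gamma_tail z alpha Hz1 Hz Hsum).
  - intros x Hx.
    destruct (newton_series z alpha Hz1 Hz Hsum x Hx M HM) as [s [H1 H2]].
    exists s. split; [exact H1|].
    apply is_series_ext with (2 := H2). intros m.
    now replace (S m - 1)%nat with m by lia.
Qed.
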